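(* Let $\mathbb{H}$ be a complex Hilbert space and let $A,B\in\mathbb{B}(\mathbb{H})$. Then $$\omega_e^2(A,B)\le\sqrt{\sqrt{\omega^4(A)+\omega^4(B)}\;\,\omega\left(|A|^2+\mathrm{i}|B|^2\right)+2\,\omega(A)\,\omega(B)\,\omega(B^*A)}.$$
   Context: $\mathbb{B}(\mathbb{H})$ is the algebra of bounded linear operators on $\mathbb{H}$, $|T|=(T^*T)^{1/2}$, $\mathrm{i}$ is the imaginary unit, and $\omega(T)=\sup_{\|x\|=1}|\langle Tx,x\rangle|$ is the numerical radius. The Euclidean operator radius of a pair is $\omega_e(A,B)=\sup_{\|x\|=1}\left(|\langle Ax,x\rangle|^2+|\langle Bx,x\rangle|^2\right)^{1/2}$. Powers such as $\omega^4(A)$ mean $(\omega(A))^4$, and $\omega_e^2(A,B)=(\omega_e(A,B))^2$. *)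

(* Defs.v *)
From HB Require Import structures.
From mathcomp Require Import all_boot all_order all_algebra complex.
From mathcomp Require Import all_classical all_reals all_analysis.

Set Implicit Arguments.
Unset Strict Implicit.
Unset Printing Implicit Defensive.

Import Order.TTheory GRing.Theory Num.Theory.
Import numFieldNormedType.Exports.

Local Open Scope classical_set_scope.
Local Open Scope ring_scope.

(* The form [inner] is linear in its first argument and conjugate-linear in its
   second one; [sqr_normE] says that the norm is the one it induces. *)
HB.mixin Record NormedModule_hasInner (R : realType) (H : Type)
    of NormedModule R[i] H := {
  inner : {dot H for @Num.conj R[i]} ;
  sqr_normE : forall x : H, `|x| ^+ 2 = inner x x
}.

#[short(type="hilbertType")]
HB.structure Definition Hilbert (R : realType) :=
  {H of CompleteNormedModule R[i] H & NormedModule_hasInner R H}.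

Section Operators.
Variables (R : realType) (H : hilbertType R).
Implicit Types (S T P A B : H -> H).

Definition bounded_operator T := linear T /\ bounded_near T (nbhs (0 : H)).

Definition is_adjoint T S := forall x y, inner (T x) y = inner x (S y).

(* Junk value 0 if there is no adjoint (there is one if T is bounded). *)
Definition adjoint T : H -> H := xget (fun=> 0) [set S | is_adjoint T S].

(* [0 <= z] for z : R[i] entails that z is real. *)
Definition positive_operator P :=
  bounded_operator P /\ forall x, 0 <= inner (P x) x.

(* Junk value 0 if T has no positive square root (it has one if T is
   positive). *)
Definition sqrt_operator T : H -> H :=
  xget (fun=> 0) [set P | positive_operator P /\ P \o P = T].

Definition abs_operator T : H -> H := sqrt_operator (adjoint T \o T).

(* [complex.Re `|z|] is the modulus of z : R[i], as an element of R.  If H = 0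
   the unit sphere is empty, and the supremum is 0. *)
Definition numerical_radius T : R :=
  sup [set complex.Re `|inner (T x) x| | x in [set x : H | `|x| = 1]].

Definition euclidean_radius A B : R :=
  sup [set Num.sqrt (complex.Re `|inner (A x) x| ^+ 2
                     + complex.Re `|inner (B x) x| ^+ 2)
      | x in [set x : H | `|x| = 1]].

End Operators.

(* Main.v *)
Require Import Defs.
From HB Require Import structures.
From mathcomp Require Import all_boot all_order all_algebra complex.
From mathcomp Require Import all_classical all_reals all_analysis.
From mathcomp Require Import ring lra.

Import Order.TTheory GRing.Theory Num.Theory.
Import numFieldNormedType.Exports.

Local Open Scope classical_set_scope.
Local Open Scope ring_scope.

(** For a unit vector [x] put [a = |<Ax,x>|] and [b = |<Bx,x>|].  Weighting
    [Ax] and [Bx] by the conjugates of [<Ax,x>] and [<Bx,x>] gives a vector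
    [u] with [<u,x> = a^2 + b^2], so [a^2 + b^2 <= |u|] by Cauchy-Schwarz.
    Expanding [|u|^2] yields
      [a^2 |Ax|^2 + b^2 |Bx|^2 + 2 Re (...)],
    where the cross term is at most [2 a b |<B^* A x,x>|] and, by
    Cauchy-Schwarz in the plane, the two squares are at most
      [sqrt (a^4 + b^4) sqrt (|Ax|^4 + |Bx|^4)].
    The last factor is the modulus of [<(|A|^2 + i |B|^2) x,x>], because
    [|A|^2 = A^* A] has quadratic form [|Ax|^2].  This is [pair_bound];
    taking suprema over the unit sphere gives the theorem.

    The argument needs the operators [A^*] and [|A|] to be the genuine ones,
    so their existence is established here.

    Adjoints come from the Riesz representation theorem
    ([riesz_representation]).  A real functional [g] is represented by the
    minimiser of [|u|^2 - 2 g u].  The proof works with near-minimisers: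
    within [d^2] of the infimum, perturbing [u] along [z] shows
    [|<z,u> - g z| <= d |z|], an inequality which makes a minimising sequence
    Cauchy and survives in the limit.

    For the square root of [A^* A], rescaling reduces to [1 - S] with [S] a
    symmetric contraction ([symmetric_contraction_sqrt]).  If [Z] solves
    [2 Z = S + Z^2] then [(1 - Z)^2 = 1 - S], and [Z] is obtained as the limit
    of [Y_(n+1) = (S + Y_n^2) / 2], [Y_0 = 0].  The iteration is dominated by
    the scalar one with [S] replaced by [1], whose distance [e_n] to its limit
    [1] satisfies [e_(n+1) = e_n - e_n^2 / 2] and decays like [2 / n]; it
    follows that [|Y_m x - Y_n x| <= e_n |x|] for [n <= m]. *)

(** * Moduli of complex numbers as real numbers *)

Definition modulus {R : realType} (z : R[i]) : R := complex.Re `|z|.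

Section Modulus.
Context {R : realType}.
Implicit Types z w : R[i].

Lemma modulusE z : `|z| = (modulus z)%:C%C.
Proof. by rewrite /modulus RRe_real // normr_real. Qed.

Lemma modulus_ge0 z : 0 <= modulus z.
Proof. by rewrite -ler0c -modulusE. Qed.

Lemma modulusM z w : modulus (z * w) = modulus z * modulus w.
Proof. by apply: complexI; rewrite rmorphM /= -!modulusE normrM. Qed.

Lemma modulus_sqr z : modulus z ^+ 2 = complex.Re z ^+ 2 + complex.Im z ^+ 2.
Proof. by apply: complexI; rewrite rmorphXn /= -modulusE add_Re2_Im2. Qed.

Lemma modulus_conj z : modulus z^* = modulus z.
Proof. by rewrite /modulus norm_conjC. Qed.

Lemma modulus_real (a : R) : modulus a%:C%C = `|a|.
Proof.
by rewrite -[LHS](ger0_norm (modulus_ge0 _)) -!sqrtr_sqr modulus_sqr /= expr0n addr0.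
Qed.

Lemma Re_le_modulus z : complex.Re z <= modulus z.
Proof.
rewrite (le_trans (ler_norm _)) // -[leRHS](ger0_norm (modulus_ge0 _)).
by rewrite -ler_sqr ?nnegrE // !real_normK ?num_real // modulus_sqr lerDl sqr_ge0.
Qed.

Lemma modulus_le z : modulus z <= `|complex.Re z| + `|complex.Im z|.
Proof.
rewrite -ler_sqr ?nnegrE ?modulus_ge0 ?addr_ge0 // modulus_sqr.
rewrite sqrrD !real_normK ?num_real // lerD2r lerDl.
by rewrite mulrn_wge0 // mulr_ge0.
Qed.

Lemma conjCE z : z^* = (complex.Re z -i* complex.Im z)%C.
Proof. by case: z. Qed.

End Modulus.

(** * The real Euclidean structure of a Hilbert space *)

(** A polynomial of degree at most two which is nonnegative everywhere has
    nonpositive discriminant.  This serves both for Cauchy-Schwarz and for the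
    variational argument of the Riesz theorem. *)
Lemma quadratic_ge0_discriminant (R : realFieldType) (a b w : R) :
  0 <= a -> 0 <= b ->
  (forall t, 0 <= a ^+ 2 + 2 * t * w + t ^+ 2 * b ^+ 2) -> `|w| <= a * b.
Proof.
move=> a0 b0 Q; rewrite -ler_sqr ?nnegrE ?mulr_ge0 // real_normK ?num_real //.
have [bz|bn] := eqVneq b 0.
  have [->|wn] := eqVneq w 0; first by rewrite expr0n sqr_ge0.
  (* At this value of t the affine polynomial would be -1. *)
  have := Q (- (a ^+ 2 + 1) / (2 * w)); rewrite bz.
  have -> : 2 * (- (a ^+ 2 + 1) / (2 * w)) * w = - (a ^+ 2 + 1) by field.
  by lra.
have bp : 0 < b ^+ 2 by rewrite exprn_gt0 // lt_def bn b0.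
have := Q (- w / b ^+ 2).
have -> : a ^+ 2 + 2 * (- w / b ^+ 2) * w + (- w / b ^+ 2) ^+ 2 * b ^+ 2
        = a ^+ 2 - w ^+ 2 / b ^+ 2 by field.
by rewrite subr_ge0 ler_pdivrMr // -exprMn.
Qed.

Section RealStructure.
Context {R : realType} {H : hilbertType R}.
Implicit Types (x y z : H) (a : R) (c : R[i]).

Definition rnorm x : R := complex.Re `|x|.
(** The real part of the inner product is a real inner product with the same
    norm, and it determines the complex one ([Im_inner]); estimates are made
    on it, where the order is total. *)
Definition rinner x y : R := complex.Re (inner x y).

Lemma rnormE x : `|x| = (rnorm x)%:C%C.
Proof. by rewrite /rnorm RRe_real // normr_real. Qed.

Lemma rnorm_ge0 x : 0 <= rnorm x.
Proof. by rewrite -ler0c -rnormE. Qed.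

Lemma rnorm0_eq0 x : rnorm x = 0 -> x = 0.
Proof. by move=> x0; apply: normr0_eq0; rewrite rnormE x0. Qed.

Lemma rnorm0 : rnorm 0 = 0.
Proof. by rewrite /rnorm normr0. Qed.

Lemma rnormN x : rnorm (- x) = rnorm x.
Proof. by rewrite /rnorm normrN. Qed.

Lemma rnormD x y : rnorm (x + y) <= rnorm x + rnorm y.
Proof. by rewrite -lecR rmorphD /= -!rnormE ler_normD. Qed.

Lemma rnormB x y : rnorm (x - y) = rnorm (y - x).
Proof. by rewrite -rnormN opprB. Qed.

Lemma rnormBD z x y : rnorm (x - y) <= rnorm (x - z) + rnorm (z - y).
Proof. by rewrite -{1}(subrK z x) -addrA rnormD. Qed.

Lemma rnormZ c x : rnorm (c *: x) = modulus c * rnorm x.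
Proof. by apply: complexI; rewrite rmorphM /= -modulusE -!rnormE normrZ. Qed.

Lemma rnormZr a x : rnorm (a%:C%C *: x) = `|a| * rnorm x.
Proof. by rewrite rnormZ modulus_real. Qed.

Lemma innerDl x y z : inner (x + y) z = inner x z + inner y z.
Proof. exact: linearDl. Qed.

Lemma innerZl c x y : inner (c *: x) y = c * inner x y.
Proof. exact: linearZl_LR. Qed.

Lemma inner_conj x y : (inner x y)^* = inner y x.
Proof. by rewrite [RHS]hermC expr0 mul1r. Qed.

Lemma innerDr x y z : inner x (y + z) = inner x y + inner x z.
Proof. by rewrite -inner_conj innerDl rmorphD /= !inner_conj. Qed.

Lemma innerZr c x y : inner x (c *: y) = c^* * inner x y.
Proof. by rewrite -inner_conj innerZl rmorphM /= inner_conj. Qed.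

Lemma inner_sqr x : inner x x = (rnorm x ^+ 2)%:C%C.
Proof. by rewrite -sqr_normE rnormE rmorphXn. Qed.

Lemma rinner_sqr x : rinner x x = rnorm x ^+ 2.
Proof. by rewrite /rinner inner_sqr. Qed.

Lemma rinnerC x y : rinner x y = rinner y x.
Proof. by rewrite /rinner -inner_conj conjCE. Qed.

Lemma rinnerDl x y z : rinner (x + y) z = rinner x z + rinner y z.
Proof. by rewrite /rinner innerDl; case: (inner x z) (inner y z) => [? ?] []. Qed.

Lemma rinnerDr x y z : rinner x (y + z) = rinner x y + rinner x z.
Proof. by rewrite rinnerC rinnerDl !(rinnerC _ x). Qed.

Lemma rinnerZl a x y : rinner (a%:C%C *: x) y = a * rinner x y.
Proof.
by rewrite /rinner innerZl; case: (inner x y) => ? ? /=; rewrite mul0r subr0.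
Qed.

Lemma rinnerZr a x y : rinner x (a%:C%C *: y) = a * rinner x y.
Proof. by rewrite rinnerC rinnerZl rinnerC. Qed.

Lemma rinnerNl x y : rinner (- x) y = - rinner x y.
Proof.
by rewrite -(scaleN1r x) -(rmorphN1 (real_complex R)) rinnerZl mulN1r.
Qed.

Lemma rinnerBl x y z : rinner (x - y) z = rinner x z - rinner y z.
Proof. by rewrite rinnerDl rinnerNl. Qed.

Lemma rinnerBr x y z : rinner x (y - z) = rinner x y - rinner x z.
Proof. by rewrite rinnerC rinnerBl !(rinnerC x). Qed.

Lemma Im_inner x y : complex.Im (inner x y) = rinner x ('i%C *: y).
Proof.
rewrite /rinner innerZr conjCE /=; case: (inner x y) => u v /=.
by rewrite mul0r sub0r mulN1r opprK.
Qed.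

Lemma rnormDsqr x y :
  rnorm (x + y) ^+ 2 = rnorm x ^+ 2 + 2 * rinner x y + rnorm y ^+ 2.
Proof.
rewrite -!rinner_sqr !(rinnerDl, rinnerDr) (rinnerC y x); ring.
Qed.

Lemma rnorm_i x : rnorm ('i%C *: x) = rnorm x.
Proof. 
rewrite rnormZ; suff -> : modulus ('i%C : R[i]) = 1 by rewrite mul1r.
by rewrite /modulus normc_def /= expr0n add0r expr1n sqrtr1.
Qed.

Lemma rinner_cauchy_schwarz x y : `|rinner x y| <= rnorm x * rnorm y.
Proof.
apply: quadratic_ge0_discriminant (rnorm_ge0 _) (rnorm_ge0 _) _ => t.
have := sqr_ge0 (rnorm (x + t%:C%C *: y)).
rewrite rnormDsqr rinnerZr rnormZr exprMn real_normK ?num_real //.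
by rewrite mulrA.
Qed.

Lemma Im_inner_le x y : `|complex.Im (inner x y)| <= rnorm x * rnorm y.
Proof. by rewrite Im_inner (le_trans (rinner_cauchy_schwarz _ _)) // rnorm_i. Qed.

Lemma rinner_ext x y : (forall z, rinner z x = rinner z y) -> x = y.
Proof.
move=> e; apply/eqP; rewrite -subr_eq0; apply/eqP/rnorm0_eq0/eqP.
by rewrite -sqrf_eq0 -rinner_sqr rinnerBr e subrr.
Qed.

(** The conclusion keeps the rate [b], so that later arguments about the limit
    stay inequalities at a fixed index. *)
Lemma cauchy_dominated (u : nat -> H) (b : nat -> R) :
  (forall n m, (n <= m)%N -> rnorm (u m - u n) <= b n) ->
  (forall e, 0 < e -> exists n, b n < e) ->
  exists l, forall n, rnorm (u n - l) <= b n.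
Proof.
move=> ub b0.
have /cauchy_cvgP/cvg_ex[l ul] : cauchy (u @ \oo).
  apply: cauchy_exP => e e0.
  have [n bn] : exists n, b n < complex.Re e.
    by apply: b0; move: e0; rewrite ltcE => /andP[].
  exists (u n); exists n => // m /= nm.
  rewrite -ball_normE /ball_ /= distrC rnormE.
  move: e0; rewrite !ltcE /= => /andP[/eqP -> _]; rewrite eqxx /=.
  exact: le_lt_trans (ub _ _ nm) bn.
exists l => n; apply/ler_addgt0Pr => e e0.
have /cvgrPdist_lt/(_ e%:C%C) := ul; rewrite ltcR => /(_ e0)[N _ uN].
have := uN (maxn n N) (leq_maxr _ _); rewrite /= rnormE ltcR => ue.
rewrite (le_trans (rnormBD (u (maxn n N)) _ _)) // lerD //.
  by rewrite rnormB ub // leq_maxl.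
by rewrite rnormB ltW.
Qed.

End RealStructure.

(** * Riesz representation and adjoints *)

Section Adjoint.
Context {R : realType} {H : hilbertType R}.
Implicit Types (x y z : H) (a : R) (c : R[i]) (T S : H -> H).

Lemma linear_add {T} : linear T -> forall x y, T (x + y) = T x + T y.
Proof. by move=> lT x y; rewrite -{1}(scale1r x) lT scale1r. Qed.

Lemma linear_zero {T} : linear T -> T 0 = 0.
Proof. by move=> lT; apply: (addrI (T 0)); rewrite -linear_add // !addr0. Qed.

Lemma linear_scale {T} : linear T -> forall c x, T (c *: x) = c *: T x.
Proof. by move=> lT c x; rewrite -[c *: x]addr0 lT linear_zero // addr0. Qed.

Lemma linear_sub {T} : linear T -> forall x y, T (x - y) = T x - T y.
Proof.
by move=> lT x y; rewrite linear_add // -(scaleN1r y) linear_scale // scaleN1r.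
Qed.

Lemma bounded_operatorP T : bounded_operator T <->
  linear T /\ exists2 M, 0 < M & forall x, rnorm (T x) <= M * rnorm x.
Proof.
split=> -[lT bT]; split=> //; pose lm := GRing.isLinear.Build _ _ _ _ T lT;
  pose F : {linear H -> H} := HB.pack T lm.
- move: bT => /(@linear_boundedP _ _ _ F)/pinfty_ex_gt0[M M0 bM].
  have MR : M = (complex.Re M)%:C%C by rewrite RRe_real // gtr0_real.
  exists (complex.Re M) => [|x]; first by rewrite -ltcR -MR.
  by rewrite -lecR rmorphM /= -MR -!rnormE bM.
- apply/(@linear_boundedP _ _ _ F); case: bT => M M0 bM.
  exists M%:C%C; split=> [|c Mc x]; first by rewrite complex_real.
  rewrite rnormE (le_trans _ (ler_wpM2r _ (ltW Mc))) //.
  by rewrite rnormE -rmorphM /= lecR bM.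
Qed.

(** Minimise [J u = |u|^2 - 2 g u].  Approximate minimality alone gives
    [near_orthogonal], so neither continuity of [J] nor existence of an exact
    minimiser has to be shown. *)
Lemma riesz_representation (g : H -> R) (M : R) :
  (forall x y, g (x + y) = g x + g y) ->
  (forall a x, g (a%:C%C *: x) = a * g x) ->
  (forall x, `|g x| <= M * rnorm x) ->
  exists y, forall x, g x = rinner x y.
Proof.
move=> gD gZ gM.
pose J x := rnorm x ^+ 2 - 2 * g x.
have Jlb x : - M ^+ 2 <= J x.
  have := sqr_ge0 (rnorm x - M); have := le_trans (ler_norm _) (gM x).
  by rewrite /J; nra.
pose I := [set J x | x in setT].
have hI : has_inf I.
  by split; [exists (J 0), 0 | exists (- M ^+ 2) => _ [x _ <-]].
have Jinf x : inf I <= J x by apply: (ge_inf hI.2); exists x.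
pose d n : R := n.+1%:R^-1.
have d0 n : 0 < d n by rewrite invr_gt0.
have [u Ju] : {u : nat -> H & forall n, J (u n) < inf I + d n ^+ 2}.
  apply: (@choice _ _ (fun n x => J x < inf I + d n ^+ 2)) => n.
  have [_ [x _ <-] lt] := inf_adherent (exprn_gt0 2 (d0 n)) hI.
  by exists x.
have near_orthogonal n z : `|rinner z (u n) - g z| <= d n * rnorm z.
  (* The quadratic in t is J (u n + t z) - J (u n) + d n ^ 2, nonnegative since
     u n is a minimiser up to d n ^ 2. *)
  apply: quadratic_ge0_discriminant (ltW (d0 n)) (rnorm_ge0 _) _ => t.
  have := Jinf (u n + t%:C%C *: z); move: (Ju n).
  rewrite /J rnormDsqr gD gZ rinnerZr rnormZr exprMn.
  rewrite real_normK ?num_real // (rinnerC z); lra.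
have dsmall e : 0 < e -> exists n, 2 * d n < e.
  move=> e0; have e20 : 0 < e / 2 by rewrite divr_gt0.
  have /cvgrPdist_lt/(_ _ e20)[N _ /(_ N (leqnn N))] := @cvg_harmonic R.
  rewrite /= sub0r normrN ger0_norm ?harmonic_ge0 // => dN.
  by exists N; move: dN; rewrite -/(d N); lra.
have [y uy] : exists y, forall n, rnorm (u n - y) <= 2 * d n.
  apply: cauchy_dominated dsmall => n m nm.
  have dm : d m <= d n by rewrite lef_pV2 ?posrE // ler_nat ltnS.
  (* Near-orthogonality at n and m, tested on z = u m - u n itself. *)
  have [->|nz] := eqVneq (u m - u n) 0.
    by rewrite rnorm0 mulr_ge0 // ltW.
  have rp : 0 < rnorm (u m - u n).
    rewrite lt_def rnorm_ge0 andbT; apply: contra_neq nz; exact: rnorm0_eq0.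
  rewrite -(ler_pM2r rp) -expr2 -rinner_sqr rinnerBr.
  have := near_orthogonal m (u m - u n).
  have := near_orthogonal n (u m - u n).
  rewrite !ler_norml => /andP[n1 n2] /andP[m1 m2].
  have := ler_wpM2r (ltW rp) dm; lra.
exists y => x; apply/eqP; rewrite -subr_eq0 -normr_eq0 eq_le normr_ge0 andbT.
apply/ler_addgt0Pr => e e0; rewrite add0r.
have K0 : 0 < 2 * (rnorm x + 1) by rewrite mulr_gt0 // ltr_wpDl ?rnorm_ge0.
have [n dn] := dsmall _ (divr_gt0 e0 K0).
rewrite (le_trans (ler_distD (rinner x (u n)) _ _)) //.
have h1 := near_orthogonal n x; rewrite distrC in h1.
have h2 := rinner_cauchy_schwarz x (u n - y); rewrite rinnerBr in h2.
have h3 := ler_wpM2l (rnorm_ge0 x) (uy n).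
move: dn; rewrite ltr_pdivlMr // => dn.
have := d0 n; have := rnorm_ge0 x; nra.
Qed.

(** For complex-linear [T], replacing [x] by [i x] in the real identity gives
    the identity between imaginary parts. *)
Lemma is_adjoint_rinner {T S} : linear T ->
  (forall x y, rinner (T x) y = rinner x (S y)) -> is_adjoint T S.
Proof.
move=> lT TS x y; have := TS ('i%C *: x) y; have := TS x y.
rewrite linear_scale // /rinner !innerZl.
by case: (inner (T x) y) (inner x (S y)) => ? ? [? ?] /= -> e; congr Complex; lra.
Qed.

Lemma adjointP {T} : bounded_operator T -> is_adjoint T (adjoint T).
Proof.
move=> /bounded_operatorP[lT [M M0 bT]].
rewrite /adjoint; case: xgetP => // notadj.
have [S TS] : {S : H -> H & forall y x, rinner (T x) y = rinner x (S y)}.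
  apply: (@choice _ _ (fun y s => forall x, rinner (T x) y = rinner x s)) => y.
  apply: (@riesz_representation (fun x => rinner (T x) y) (M * rnorm y)).
  - by move=> x1 x2; rewrite linear_add // rinnerDl.
  - by move=> a x; rewrite linear_scale // rinnerZl.
  - move=> x; rewrite (le_trans (rinner_cauchy_schwarz _ _)) // mulrAC.
    by rewrite ler_wpM2r ?rnorm_ge0.
by case: (notadj S); apply: is_adjoint_rinner => // x y.
Qed.

Lemma adjoint_linear {T S} : is_adjoint T S -> linear S.
Proof.
move=> TS c x y; apply: rinner_ext => z.
by rewrite /rinner -TS innerDr innerZr innerDr innerZr !TS.
Qed.

Lemma adjoint_bound {T S M} : 0 <= M -> is_adjoint T S ->
  (forall x, rnorm (T x) <= M * rnorm x) ->
  forall x, rnorm (S x) <= M * rnorm x.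
Proof.
move=> M0 TS bT x; have [->|Sn] := eqVneq (rnorm (S x)) 0.
  by rewrite mulr_ge0 ?rnorm_ge0.
have Sp : 0 < rnorm (S x) by rewrite lt_def Sn rnorm_ge0.
rewrite -(ler_pM2l Sp) -expr2 -rinner_sqr /rinner -TS -/(rinner _ _).
rewrite (le_trans (ler_norm _)) // (le_trans (rinner_cauchy_schwarz _ _)) //.
by rewrite mulrA (mulrC _ M) ler_wpM2r ?rnorm_ge0.
Qed.

End Adjoint.

(** * Square root of the complement of a symmetric contraction *)

Section ErrorSequence.
Context {R : realType}.

(** The error [1 - y_n] of the scalar iteration [y_(n+1) = (1 + y_n^2) / 2],
    [y_0 = 0], which converges to [1]. *)
Fixpoint sqrt_error (n : nat) : R :=
  if n is m.+1 then sqrt_error m - sqrt_error m ^+ 2 / 2 else 1.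

Lemma sqrt_error_itv n : 0 <= sqrt_error n <= 1.
Proof. by elim: n => [|n /andP[IH0 IH1]] /=; [lra | apply/andP; split; nra]. Qed.

(** The map [e |-> e - e^2 / 2] is increasing on [[0, 1]], so the induction
    only has to compare the two sides at [e = 2 / (n + 2)]. *)
Lemma sqrt_error_harmonic n : sqrt_error n <= 2 / n.+2%:R.
Proof.
elim: n => [|n IH] /=; first by rewrite divff.
have /andP[e0 e1] := sqrt_error_itv n.
set d := 2 / n.+2%:R in IH.
have d1 : d <= 1 by rewrite ler_pdivrMr // mul1r ler_nat.
apply: (@le_trans _ _ (d - d ^+ 2 / 2)); first by nra.
rewrite /d -[n.+3]addn1 -[n.+2]addn1 -[n.+1]addn1 !natrD.
have n0 : 0 <= n%:R :> R by [].
rewrite ler_pdivlMr; last lra.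
have -> : (2 / (n%:R + 1 + 1) - (2 / (n%:R + 1 + 1)) ^+ 2 / 2) * (n%:R + 1 + 1 + 1)
  = 2 - 2 / (n%:R + 2) ^+ 2 :> R by field; lra.
by rewrite gerBl divr_ge0 // exprn_ge0 //; lra.
Qed.

Lemma sqrt_error_small C e : 0 < e -> exists n, sqrt_error n * C < e.
Proof.
move=> e0; have C0 : 0 < `|C| + 1 by rewrite ltr_wpDl.
have d0 : 0 < e / (2 * (`|C| + 1)) by rewrite divr_gt0 // mulr_gt0.
have /cvgrPdist_lt/(_ _ d0)[N _ /(_ N (leqnn N))] := @cvg_harmonic R.
rewrite /= sub0r normrN ger0_norm ?harmonic_ge0 // ltr_pdivlMr ?mulr_gt0 // => dN.
exists N; have /andP[s0 _] := sqrt_error_itv N.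
apply: le_lt_trans dN; rewrite mulrA.
apply: (@le_trans _ _ (sqrt_error N * (`|C| + 1))).
  by rewrite ler_wpM2l // (le_trans (ler_norm _)) // lerDl.
rewrite ler_wpM2r ?(ltW C0) // (le_trans (sqrt_error_harmonic N)) // mulrC.
by rewrite ler_wpM2r // lef_pV2 ?posrE // ler_nat.
Qed.

End ErrorSequence.

Section SquareRoot.
Context {R : realType} {H : hilbertType R}.
Implicit Types (x y z : H) (a : R) (c : R[i]) (T S : H -> H).

Local Notation eps := (@sqrt_error R).

Lemma eq0_le_sqrt_error x C : (forall n, rnorm x <= eps n * C) -> x = 0.
Proof.
move=> xC; apply/rnorm0_eq0/eqP; rewrite eq_le rnorm_ge0 andbT.
apply/ler_addgt0Pr => e e0; rewrite add0r.
by have [n lt] := sqrt_error_small C _ e0; rewrite (le_trans (xC n)) // ltW.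
Qed.

Context (S : H -> H) (linS : linear S).
Context (symS : forall x y, inner (S x) y = inner x (S y)).
Context (contrS : forall x, rnorm (S x) <= rnorm x).

(** The iteration for [Z = (S + Z^2) / 2]; then [1 - Z] is a square root of
    [1 - S]. *)
Fixpoint sqrt_iter (n : nat) : H -> H :=
  if n is m.+1 then
    fun x => (2^-1 : R)%:C%C *: (S x + sqrt_iter m (sqrt_iter m x))
  else fun=> 0.

Local Notation Y := sqrt_iter.

Lemma sqrt_iter_linear n : linear (Y n).
Proof.
elim: n => [|n IH] c x y /=; first by rewrite scaler0 addr0.
rewrite linS !IH !scalerDr !scalerA (mulrC c) addrACA //.
Qed.

Lemma sqrt_iter_symmetric n x y : inner (Y n x) y = inner x (Y n y).
Proof.
elim: n x y => [|n IH] x y /=.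
  by rewrite -(scale0r 0) innerZl innerZr conjC0 !mul0r.
by rewrite innerZl innerZr !innerDl !innerDr !IH symS conjCE /= oppr0.
Qed.

Lemma sqrt_iter_bound n x : rnorm (Y n x) <= (1 - eps n) * rnorm x.
Proof.
elim: n x => [|n IH] x /=; first by rewrite rnorm0 subrr mul0r.
rewrite rnormZr ger0_norm ?invr_ge0 //.
have /andP[e0 e1] := sqrt_error_itv n : 0 <= eps n <= 1.
have h1 := rnormD (S x) (Y n (Y n x)); have h2 := contrS x.
have h3 := IH (Y n x).
have h4 : (1 - eps n) * rnorm (Y n x) <= (1 - eps n) * ((1 - eps n) * rnorm x).
  by rewrite ler_wpM2l ?subr_ge0.
by lra.
Qed.

(** Since [Y_(n+1)^2 - Y_n^2 = Y_(n+1) (Y_(n+1) - Y_n) + (Y_(n+1) - Y_n) Y_n],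
    the increments obey the same recursive bound as the scalar ones, with no
    appeal to the commutation of the iterates. *)
Lemma sqrt_iter_step n x :
  rnorm (Y n.+1 x - Y n x) <= eps n ^+ 2 / 2 * rnorm x.
Proof.
elim: n x => [|n IH] x.
  rewrite /= addr0 subr0 rnormZr ger0_norm ?invr_ge0 // expr1n mul1r.
  by rewrite ler_wpM2l ?invr_ge0.
have -> : Y n.+2 x - Y n.+1 x = (2^-1 : R)%:C%C *:
    (Y n.+1 (Y n.+1 x - Y n x) + (Y n.+1 (Y n x) - Y n (Y n x))).
  rewrite (linear_sub (sqrt_iter_linear n.+1)) addrA subrK.
  by rewrite [Y n.+2]/= [Y n.+1 x in X in _ - X]/= -scalerBr; congr (_ *: _);
    rewrite opprD addrACA subrr add0r.
rewrite rnormZr ger0_norm ?invr_ge0 //.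
have /andP[e0 e1] := sqrt_error_itv n : 0 <= eps n <= 1.
have /andP[f0 f1] := sqrt_error_itv n.+1 : 0 <= eps n.+1 <= 1.
have ef : eps n.+1 = eps n - eps n ^+ 2 / 2 by [].
have h1 := rnormD (Y n.+1 (Y n.+1 x - Y n x)) (Y n.+1 (Y n x) - Y n (Y n x)).
have h2 := sqrt_iter_bound n.+1 (Y n.+1 x - Y n x).
have h3 : (1 - eps n.+1) * rnorm (Y n.+1 x - Y n x) <=
          (1 - eps n.+1) * (eps n ^+ 2 / 2 * rnorm x).
  by rewrite ler_wpM2l ?subr_ge0.
have h4 := IH (Y n x).
have h5 : eps n ^+ 2 / 2 * rnorm (Y n x) <=
          eps n ^+ 2 / 2 * ((1 - eps n) * rnorm x).
  by rewrite ler_wpM2l ?sqrt_iter_bound // divr_ge0 ?sqr_ge0.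
apply: (@le_trans _ _ (2^-1 * ((1 - eps n.+1) * (eps n ^+ 2 / 2 * rnorm x)
   + eps n ^+ 2 / 2 * ((1 - eps n) * rnorm x)))).
  by rewrite ler_wpM2l ?invr_ge0 //; lra.
by rewrite ef le_eqVlt; apply/orP; left; apply/eqP; field.
Qed.

Lemma sqrt_iter_cauchy n m x : (n <= m)%N ->
  rnorm (Y m x - Y n x) <= eps n * rnorm x.
Proof.
move=> nm; have /andP[e0 _] := sqrt_error_itv m : 0 <= eps m <= 1.
apply: (@le_trans _ _ ((eps n - eps m) * rnorm x)); last first.
  by rewrite ler_wpM2r ?rnorm_ge0 // gerBl.
move=> {e0}; elim: m nm => [|m IH].
  by rewrite leqn0 => /eqP ->; rewrite !subrr rnorm0 mul0r lexx.
rewrite leq_eqVlt => /predU1P[->|]; first by rewrite !subrr rnorm0 mul0r lexx.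
rewrite ltnS => /IH {}IH.
rewrite (le_trans (rnormBD (Y m x) _ _)) //.
have := sqrt_iter_step m x.
have -> : eps m.+1 = eps m - eps m ^+ 2 / 2 by []; lra.
Qed.

(** The square root is [1 - Z] for the pointwise limit [Z] of the iterates.
    Every property of [Z] is read off from [|Y_n x - Z x| <= e_n |x|]:
    linearity and the fixed-point equation hold up to an error proportional to
    [e_n], and positivity of [1 - Z] follows from [|Z| <= 1]. *)
Lemma symmetric_contraction_sqrt :
  exists P, positive_operator P /\ forall x, P (P x) = x - S x.
Proof.
have [Z YZ] : {Z : H -> H & forall x n, rnorm (Y n x - Z x) <= eps n * rnorm x}.
  apply: (@choice _ _ (fun x l => forall n, rnorm (Y n x - l) <= eps n * rnorm x)).
  move=> x; apply: (@cauchy_dominated _ _ (Y^~ x)) => [n m|e].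
    exact: sqrt_iter_cauchy.
  exact: sqrt_error_small.
have linZ : linear Z.
  move=> c x y; apply/eqP; rewrite -subr_eq0; apply/eqP.
  pose C := rnorm (c *: x + y) + (modulus c * rnorm x + rnorm y).
  apply: (@eq0_le_sqrt_error _ C) => n; rewrite /C {C}.
  have -> : Z (c *: x + y) - (c *: Z x + Z y) =
     - (Y n (c *: x + y) - Z (c *: x + y)) +
     (c *: (Y n x - Z x) + (Y n y - Z y)).
    rewrite opprB scalerBr [X in _ = _ + X]addrACA -opprD addrA.
    by rewrite sqrt_iter_linear subrK.
  rewrite (le_trans (rnormD _ _)) // rnormN mulrDr lerD //.
  rewrite (le_trans (rnormD _ _)) //.
  rewrite mulrDr lerD // rnormZ mulrCA ler_wpM2l ?modulus_ge0 //.
have contrZ x : rnorm (Z x) <= rnorm x.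
  by have := YZ x 0%N; rewrite /= sub0r rnormN mul1r.
have fixZ x : S x + Z (Z x) = 2%:R%:C%C *: Z x.
  apply/eqP; rewrite -subr_eq0; apply/eqP.
  apply: (@eq0_le_sqrt_error _ (rnorm (Z x) + 3 * rnorm x)) => n.
  have /andP[e0 e1] := sqrt_error_itv n : 0 <= eps n <= 1.
  have -> : S x + Z (Z x) - 2%:R%:C%C *: Z x =
    - (Y n (Z x) - Z (Z x)) +
    (- Y n (Y n x - Z x) + 2%:R%:C%C *: (Y n.+1 x - Z x)).
    rewrite (linear_sub (sqrt_iter_linear n)) scalerBr [Y n.+1 x]/= scalerA -rmorphM.
    rewrite divff // rmorph1 scale1r !opprB (addrC (S x) (Y n _)).
    by rewrite !addrA !subrK (addrC (S x)).
  have h1 := YZ (Z x) n; have h2 := sqrt_iter_bound n (Y n x - Z x).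
  have h3 := YZ x n; have h4 := YZ x n.+1.
  have h5 : eps n.+1 * rnorm x <= eps n * rnorm x.
    by rewrite ler_wpM2r ?rnorm_ge0 // /= gerBl divr_ge0 ?sqr_ge0.
  have h6 : 0 <= eps n * rnorm (Y n x - Z x) by rewrite mulr_ge0 ?rnorm_ge0.
  rewrite (le_trans (rnormD _ _)) // rnormN.
  have h7 := rnormD (- Y n (Y n x - Z x)) (2%:R%:C%C *: (Y n.+1 x - Z x)).
  move: h7; rewrite rnormN rnormZr ger0_norm // => h7.
  lra.
exists (fun x => x - Z x); split; last first.
  move=> x; rewrite (linear_sub linZ) -addrA -opprD; congr (x - _).
  have ZZ : S x + Z (Z x) = Z x + Z x.
    by rewrite fixZ -[2]natr1 rmorphD rmorph1 scalerDl !scale1r.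
  by rewrite addrA -ZZ addrK.
split.
  apply/bounded_operatorP; split.
    by move=> c x y; rewrite linZ scalerBr opprD addrACA.
  exists 2 => // x; rewrite (le_trans (rnormD _ _)) // rnormN.
  by have := contrZ x; lra.
move=> x; rewrite lecE /=; apply/andP; split; last first.
  rewrite -/(rinner _ _) rinnerBl rinner_sqr subr_ge0.
  rewrite (le_trans (ler_norm _)) // (le_trans (rinner_cauchy_schwarz _ _)) // expr2.
  by rewrite ler_wpM2r ?rnorm_ge0.
(* The form of each Y n is real by symmetry, hence so is that of its limit. *)
rewrite -normr_eq0 eq_le normr_ge0 andbT; apply/ler_addgt0Pr => e e0; rewrite add0r.
have [n lt] := sqrt_error_small (rnorm x * rnorm x) _ e0.
have Y0 : complex.Im (inner (Y n x) x) = 0.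
  have := inner_conj (Y n x) x; rewrite -sqrt_iter_symmetric conjCE.
  by case: (inner _ _) => u v [] /=; lra.
have -> : complex.Im (inner (x - Z x) x) = complex.Im (inner (Y n x - Z x) x).
  rewrite !Im_inner !rinnerBl -!Im_inner Y0 inner_sqr //.
rewrite (le_trans (Im_inner_le _ _)) // (le_trans _ (ltW lt)) // mulrA.
by rewrite ler_wpM2r ?rnorm_ge0.
Qed.

End SquareRoot.
Arguments symmetric_contraction_sqrt {R H S}.

(** * The absolute value of an operator *)

Section AbsoluteValue.
Context {R : realType} {H : hilbertType R}.
Implicit Types (x y z : H) (A B T : H -> H).

Lemma inner_adjoint {A} x y : bounded_operator A ->
  inner (adjoint A x) y = inner x (A y).
Proof. by move=> bA; rewrite -[LHS]inner_conj -adjointP // inner_conj. Qed.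

(** With [M] a bound for [A], the operator [S = 1 - M^-2 A^* A] is a contraction:
    [|Sx|^2 = |x|^2 - 2 M^-2 |Ax|^2 + M^-4 |A^* A x|^2], and the last term is at
    most [M^-2 |Ax|^2].  Multiply the square root of [1 - S] by [M]. *)
Lemma gram_sqrt {A} : bounded_operator A ->
  exists P, positive_operator P /\ P \o P = adjoint A \o A.
Proof.
move=> bA; have [linA [M M0 boundA]] := (bounded_operatorP A).1 bA.
have adjA := adjointP bA; have linA' := adjoint_linear adjA.
have boundA' := adjoint_bound (ltW M0) adjA boundA.
pose k : R := (M ^+ 2)^-1; have M2 : 0 < M ^+ 2 by rewrite exprn_gt0.
have k0 : 0 < k by rewrite invr_gt0.
pose S x := x - k%:C%C *: adjoint A (A x).
have linS : linear S.
  move=> c x y; rewrite /S linA linA' scalerBr scalerDr opprD.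
  by rewrite addrACA !scalerA (mulrC c).
have symS x y : inner (S x) y = inner x (S y).
  rewrite -[RHS]inner_conj /S -!scaleNr !innerDl !innerZl rmorphD rmorphM /=.
  rewrite !inner_adjoint // !inner_conj; congr (_ + _ * _).
  by rewrite conjCE /= oppr0.
have contrS x : rnorm (S x) <= rnorm x.
  rewrite -ler_sqr ?nnegrE ?rnorm_ge0 // rnormDsqr rnormN rnormZr.
  rewrite ger0_norm ?(ltW k0) //.
  rewrite -[- (_ *: _)]scaleNr -rmorphN /= rinnerZr rinnerC.
  have -> : rinner (adjoint A (A x)) x = rnorm (A x) ^+ 2.
    by rewrite /rinner inner_adjoint // -/(rinner _ _) rinner_sqr.
  have h : (k * rnorm (adjoint A (A x))) ^+ 2 <= k * rnorm (A x) ^+ 2.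
    rewrite exprMn expr2 -mulrA ler_pM2l // /k ler_pdivrMl // -exprMn.
    by rewrite ler_sqr ?nnegrE ?boundA' ?mulr_ge0 ?rnorm_ge0 // ltW.
  have : 0 <= k * rnorm (A x) ^+ 2 by rewrite mulr_ge0 ?sqr_ge0 ?(ltW k0).
  lra.
have [P [[bP posP] PP]] := symmetric_contraction_sqrt linS symS contrS.
have [linP [L L0 boundP]] := (bounded_operatorP P).1 bP.
exists (fun x => M%:C%C *: P x); split; last first.
  apply/funext => x /=; rewrite linear_scale // scalerA PP /S subKr scalerA.
  by rewrite -!rmorphM /= -expr2 divff ?gt_eqF // scale1r.
split; last by move=> x; rewrite innerZl mulr_ge0 // ler0c ltW.
apply/bounded_operatorP; split.
  by move=> c x y; rewrite linP scalerDr !scalerA mulrC.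
exists (M * L); first exact: mulr_gt0.
by move=> x; rewrite rnormZr ger0_norm ?(ltW M0) // -mulrA ler_pM2l.
Qed.

Lemma abs_operator_sqr A : bounded_operator A ->
  forall x, abs_operator A (abs_operator A x) = adjoint A (A x).
Proof.
move=> bA x; have [P sqrtP] := gram_sqrt bA.
rewrite /abs_operator /sqrt_operator.
by case: xgetP => [Q _ [_ /(congr1 (@^~ x))]|/(_ P)].
Qed.

(** * The numerical radius inequality *)

(** Boundedness matters: the supremum of an unbounded set is [0] by
    convention. *)
Lemma numerical_radius_ge {T M} : (forall x, rnorm (T x) <= M * rnorm x) ->
  forall {x}, `|x| = 1 -> modulus (inner (T x) x) <= numerical_radius T.
Proof.
move=> bT x x1; apply: ub_le_sup; last by exists x.
exists (M + M) => _ [y /= y1 <-]; have ny : rnorm y = 1 by rewrite /rnorm y1.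
rewrite (le_trans (modulus_le _)) //.
have := rinner_cauchy_schwarz (T y) y; have := Im_inner_le (T y) y; have := bT y.
by rewrite ny !mulr1 /rinner; lra.
Qed.

Lemma abs_pair_numerical_range A B x :
  bounded_operator A -> bounded_operator B ->
  modulus (inner (abs_operator A (abs_operator A x)
             + 'i%C *: abs_operator B (abs_operator B x)) x) =
  Num.sqrt (rnorm (A x) ^+ 4 + rnorm (B x) ^+ 4).
Proof.
move=> bA bB; rewrite !abs_operator_sqr // innerDl innerZl !inner_adjoint //.
rewrite !inner_sqr -[LHS](ger0_norm (modulus_ge0 _)) -sqrtr_sqr modulus_sqr /=.
by rewrite !(mul0r, mul1r, mulr0, oppr0, addr0, add0r) -!exprM.
Qed.

Lemma cauchy_schwarz_plane (a b c d : R) :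
  a * c + b * d <= Num.sqrt (a ^+ 2 + b ^+ 2) * Num.sqrt (c ^+ 2 + d ^+ 2).
Proof.
rewrite -sqrtrM ?addr_ge0 ?sqr_ge0 // (le_trans (ler_norm _)) //.
rewrite -sqrtr_sqr ler_wsqrtr //.
have := sqr_ge0 (a * d - b * c); lra.
Qed.

(** The pointwise form of the theorem, for the vector
    [u = conj <Ax,x> Ax + conj <Bx,x> Bx]. *)
Lemma pair_bound A {B x} : bounded_operator B -> `|x| = 1 ->
  let a := modulus (inner (A x) x) in let b := modulus (inner (B x) x) in
  (a ^+ 2 + b ^+ 2) ^+ 2 <=
  Num.sqrt (a ^+ 4 + b ^+ 4) * Num.sqrt (rnorm (A x) ^+ 4 + rnorm (B x) ^+ 4)
  + 2 * a * b * modulus (inner (adjoint B (A x)) x).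
Proof.
move=> bB x1 /=.
set a := modulus (inner (A x) x); set b := modulus (inner (B x) x).
have nx : rnorm x = 1 by rewrite /rnorm x1.
pose v := (inner (A x) x)^* *: A x; pose w := (inner (B x) x)^* *: B x.
have ab : a ^+ 2 + b ^+ 2 = rinner (v + w) x.
  rewrite /rinner innerDl !innerZl !(mulrC _^*) -!normCK.
  by rewrite !modulusE -!rmorphXn.
have abw : a ^+ 2 + b ^+ 2 <= rnorm (v + w).
  rewrite ab (le_trans (ler_norm _)) //.
  by rewrite (le_trans (rinner_cauchy_schwarz _ _)) // nx mulr1.
have ab0 : 0 <= a ^+ 2 + b ^+ 2 by rewrite addr_ge0 ?sqr_ge0.
apply: (@le_trans _ _ (rnorm (v + w) ^+ 2)).
  by rewrite ler_sqr ?nnegrE ?rnorm_ge0.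
have nv : rnorm v = a * rnorm (A x) by rewrite rnormZ modulus_conj.
have nw : rnorm w = b * rnorm (B x) by rewrite rnormZ modulus_conj.
have vw : rinner v w <= a * b * modulus (inner (adjoint B (A x)) x).
  rewrite (le_trans (Re_le_modulus _)) // innerZl innerZr !modulusM !modulus_conj.
  by rewrite inner_adjoint // mulrA.
rewrite rnormDsqr nv nw !exprMn.
have := cauchy_schwarz_plane (a ^+ 2) (b ^+ 2)
  (rnorm (A x) ^+ 2) (rnorm (B x) ^+ 2).
by rewrite -!exprM; lra.
Qed.

End AbsoluteValue.

Theorem theorem2p3 (R : realType) (H : hilbertType R) (A B : H -> H)
    (hA : bounded_operator A) (hB : bounded_operator B) :
  euclidean_radius A B ^+ 2 <=
  Num.sqrt
    (Num.sqrt (numerical_radius A ^+ 4 + numerical_radius B ^+ 4)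
     * numerical_radius
         (fun x : H => abs_operator A (abs_operator A x)
                   + ('i)%C *: abs_operator B (abs_operator B x))
     + 2 * numerical_radius A * numerical_radius B
       * numerical_radius (adjoint B \o A)).
Proof.
have [linA [M M0 boundA]] := (bounded_operatorP A).1 hA.
have [linB [N N0 boundB]] := (bounded_operatorP B).1 hB.
have boundA' := adjoint_bound (ltW M0) (adjointP hA) boundA.
have boundB' := adjoint_bound (ltW N0) (adjointP hB) boundB.
set G := fun x => _ + _.
have boundG x : rnorm (G x) <= (M * M + N * N) * rnorm x.
  rewrite /G !abs_operator_sqr // (le_trans (rnormD _ _)) // rnorm_i.
  rewrite mulrDl -!mulrA.
  by rewrite lerD // (le_trans (boundA' _), le_trans (boundB' _)) // ler_pM2l.
have boundBA x : rnorm (adjoint B (A x)) <= N * M * rnorm x.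
  by rewrite -mulrA (le_trans (boundB' _)) // ler_pM2l.
set K := (X in Num.sqrt X).
have K4 x : `|x| = 1 ->
    Num.sqrt (modulus (inner (A x) x) ^+ 2 + modulus (inner (B x) x) ^+ 2)
    <= Num.sqrt (Num.sqrt K).
  move=> x1; rewrite ler_wsqrtr // -[leLHS]ger0_norm ?addr_ge0 ?sqr_ge0 //.
  rewrite -sqrtr_sqr ler_wsqrtr // (le_trans (pair_bound A hB x1)) //.
  have wA := numerical_radius_ge boundA x1.
  have wB := numerical_radius_ge boundB x1.
  have wG := numerical_radius_ge boundG x1.
  have wBA := numerical_radius_ge boundBA x1.
  rewrite /G abs_pair_numerical_range // in wG.
  rewrite lerD // ler_pM ?sqrtr_ge0 ?mulr_ge0 ?modulus_ge0 //.
    have A0 := le_trans (modulus_ge0 _) wA.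
    have B0 := le_trans (modulus_ge0 _) wB.
    by rewrite ler_wsqrtr // lerD // lerXn2r ?nnegrE ?modulus_ge0.
  by rewrite ler_pM ?mulr_ge0 ?modulus_ge0 // ler_pM2l.
rewrite /euclidean_radius; set E := [set _ | _ in _].
have ubE : ubound E (Num.sqrt (Num.sqrt K)) by move=> _ [x x1 <-]; exact: K4.
(* The unit sphere, hence E, is empty when the space is trivial. *)
have [->|/set0P[e Ee]] := eqVneq E set0; first by rewrite sup0 expr0n sqrtr_ge0.
have supE : sup E <= Num.sqrt (Num.sqrt K) by apply: ge_sup => //; exists e.
have e0 : 0 <= e by case: Ee => x _ <-; exact: sqrtr_ge0.
have eE : e <= sup E by apply: ub_le_sup => //; exists (Num.sqrt (Num.sqrt K)).
rewrite -[leRHS]sqr_sqrtr ?sqrtr_ge0 // ler_sqr ?nnegrE ?sqrtr_ge0 //.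
exact: le_trans eE.
Qed.
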